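(* Let $E=\bigsqcup_{n\in\omega}E_n$ be a continuous signature and let $X$ be a topological $E$-algebra. If for every $n\in\mathrm{Sp}\,E$ the product $X^n$ is $\mathbb R$-factorizable over $E_n$, then the topological $E$-algebra $X$ is $\mathbb R$-factorizable.
   Context: All spaces are Tychonoff. A continuous signature is a space $E$ that is the disjoint union of clopen (possibly empty) subsets $E_n$, $n\in\omega=\{0,1,2,\dots\}$; $\mathrm{Sp}\,E=\{n\in\omega: E_n\ne\varnothing\}$. An $E$-algebra is a set $X$ with maps $\mathfrak e^X_n\colon E_n\times X^n\to X$, $n\in\omega$ ($X^0$ is a singleton). A topological $E$-algebra is an $E$-algebra endowed with a topology making all $\mathfrak e^X_n$ continuous. A homomorphism is a map commuting with all operations. A topological $E$-algebra $X$ is $\mathbb R$-factorizable if for every continuous $f\colon X\to\mathbb R$ there are a separable metrizable topological $E$-algebra $Y$, a continuous function $g\colon Y\to\mathbb R$ and a continuous homomorphism $h\colon X\to Y$ with $f=g\circ h$. For spaces $T,X_1,\dots,X_n$, the product $\prod_{i=1}^nX_i$ is $\mathbb R$-factorizable over $T$ if for every continuous function $f\colon T\times\prod_{i=1}^nX_i\to\mathbb R$ there are separable metrizable spaces $Y_1,\dots,Y_n$, continuous maps $h_i\colon X_i\to Y_i$, and a continuous function $g\colon T\times\prod_{i=1}^nY_i\to\mathbb R$ such that $f=g\circ(\mathrm{id}_T\times\prod_{i=1}^nh_i)$. *)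

(* Defs.v *)
From HB Require Import structures.
From mathcomp Require Import all_boot all_order all_algebra.
From mathcomp Require Import all_classical all_reals all_analysis.

Set Implicit Arguments.
Unset Strict Implicit.
Unset Printing Implicit Defensive.

Import Order.TTheory GRing.Theory Num.Theory.
Import numFieldNormedType.Exports.

Local Open Scope classical_set_scope.
Local Open Scope ring_scope.

(* All spaces are Tychonoff: this is recorded in [continuous_signature] and
   [topEalgebra], and it is automatic for metrizable spaces. A [topologicalType]
   may be empty. *)

(* [completely_regular_space] is phrased with [uniform_separator], which
   [uniform_separatorP] turns into separation by a continuous real function. *)
Definition tychonoff (T : topologicalType) : Prop :=
  hausdorff_space T /\ completely_regular_space T.

Definition metrizable_space (R : realType) (T : topologicalType) : Prop :=
  exists d : T -> T -> R,
    [/\ forall x y, d x y = 0 <-> x = y,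
        forall x y, d x y = d y x,
        forall x y z, d x z <= d x y + d y z &
        forall x, nbhs x = nbhs_ball_ (fun y e => [set z | d y z < e]) x].

Definition separable_space (T : topologicalType) : Prop :=
  exists2 D : set T, countable D & dense D.

Definition continuous_signature (E : topologicalType) (E_ : nat -> set E) :
    Prop :=
  [/\ tychonoff E, forall n, clopen (E_ n), trivIset setT E_ &
      \bigcup_n E_ n = setT].

Definition Sp (E : Type) (E_ : nat -> set E) : set nat :=
  [set n | E_ n !=set0].

(* The n-th power of X is [{ptws 'I_n -> X}], i.e. ['I_n -> X] with the product
   topology, and [E_ n], seen as a type, carries the subspace topology. *)
Definition ealgebra_ops (E : Type) (E_ : nat -> set E) (X : Type) : Type :=
  forall n : nat, E_ n * {ptws 'I_n -> X} -> X.

Record topEalgebra (E : topologicalType) (E_ : nat -> set E) := TopEalgebra {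
  ealg_sort :> topologicalType;
  ealg_op : ealgebra_ops E_ ealg_sort;
  ealg_tychonoff : tychonoff ealg_sort;
  ealg_op_continuous : forall n, continuous (ealg_op (n := n))
}.

Definition ehomomorphism (E : topologicalType) (E_ : nat -> set E)
    (X Y : topEalgebra E_) (h : X -> Y) : Prop :=
  forall (n : nat) (c : E_ n) (x : {ptws 'I_n -> X}),
    h (ealg_op (c, x)) = ealg_op (c, h \o x).

Definition Rfactorizable (R : realType) (E : topologicalType)
    (E_ : nat -> set E) (X : topEalgebra E_) : Prop :=
  forall f : X -> R, continuous f ->
    exists (Y : topEalgebra E_) (g : Y -> R) (h : X -> Y),
      [/\ separable_space Y /\ metrizable_space R Y, continuous g,
          continuous h /\ ehomomorphism h & f = g \o h].

Definition Rfactorizable_over (R : realType) (T : topologicalType) (n : nat)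
    (X : 'I_n -> topologicalType) : Prop :=
  forall f : T * prod_topology X -> R, continuous f ->
    exists (Y : 'I_n -> topologicalType) (h : forall i, X i -> Y i)
           (g : T * prod_topology Y -> R),
      [/\ forall i, separable_space (Y i) /\ metrizable_space R (Y i),
          forall i, continuous (h i), continuous g &
          f = g \o (fun p => (p.1, fun i => h i (p.2 i)))].

(* Main.v *)
(* Starting from [f], close up: for a continuous [phi : X -> R] and an arity
   [n], factor [phi] composed with the [n]-ary operation through separable metric
   spaces [Y_i] by maps [h_i], and add the countably many functions
   [x |-> d_i (h_i x) q], [q] in a countable dense subset of [Y_i]. After omega
   steps this gives a countable family [F], i.e. a map [F : X -> R^nat], such
   that all the functions [F_m (op (c, x))] are continuous for the coarser
   topology on [X] induced by [F]. The operations therefore descend to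
   continuous operations on the image of [F], a subspace of [R^nat]. *)

Require Import Defs.
From mathcomp Require Import all_boot all_order all_algebra.
From mathcomp Require Import all_classical all_reals all_analysis.
From mathcomp Require Import lra.

Set Implicit Arguments.
Unset Strict Implicit.
Unset Printing Implicit Defensive.

Import Order.TTheory GRing.Theory Num.Theory.
Import numFieldNormedType.Exports.

Local Open Scope classical_set_scope.
Local Open Scope ring_scope.

Lemma continuous_prod_topology (T : topologicalType) (I : Type)
    (Y : I -> topologicalType) (f : T -> prod_topology Y) :
  (forall i, continuous (fun t => f t i)) -> continuous f.
Proof.
move=> cf t; apply/cvg_sup => i.
exact: (@continuous_comp_initial _ T _ (fun y : prod_topology Y => y i) f (cf i)).
Qed.

Lemma continuous_injective_hausdorff (S T : topologicalType) (f : S -> T) :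
  continuous f -> injective f -> hausdorff_space T -> hausdorff_space S.
Proof.
move=> cf injf hT p q pq; apply/injf/hT => A B /cf fA /cf fB.
by have [z [Az Bz]] := pq _ _ fA fB; exists (f z).
Qed.

(** * Continuity into metric spaces and metrizability *)

Section metric.
Context (R : realType) (Y : topologicalType) (d : Y -> Y -> R).
Hypothesis dxx : forall x, d x x = 0.
Hypothesis dC : forall x y, d x y = d y x.
Hypothesis dD : forall x y z, d x z <= d x y + d y z.
Hypothesis dE :
  forall x, nbhs x = nbhs_ball_ (fun y e => [set z | d y z < e]) x.

Lemma continuous_dist (a : Y) : continuous (d^~ a).
Proof.
move=> y; apply/cvgrPdist_lt => e e0.
suff : nbhs y [set z | `|d y a - d z a| < e] by [].
rewrite dE; exists e => //= z /= dyz.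
have := dD y z a; have := dD z y a; rewrite (dC z y) ltr_norml.
by lra.
Qed.

(** If [a] in [D] is within [e / 2] of [h t], then [d (h s) a < e / 2] forces [d (h t) (h s) < e].
    Continuity into a separable metric space thus reduces to countably many real functions. *)
Lemma continuous_dist_dense (T : topologicalType) (D : set Y) (h : T -> Y) :
  dense D -> (forall a, D a -> continuous (fun t => d (h t) a)) ->
  continuous h.
Proof.
move=> denD ch t U; rewrite dE => -[e /= e0 eU].
have e20 : 0 < e / 2 by lra.
have oB : open [set z | d (h t) z < e / 2].
  rewrite openE => z /= dz; rewrite /interior dE.
  exists (e / 2 - d (h t) z); first by rewrite /= subr_gt0.
  by move=> w /=; have := dD (h t) z w; lra.
have [|a [/= ha Da]] := denD _ _ oB; first by exists (h t) => /=; rewrite dxx.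
have /cvgr_lt /(_ (e / 2) ha) : d (h s) a @[s --> t] --> d (h t) a.
  exact: ch.
apply: filterS => s hs; apply: eU => /=.
by have := dD (h t) a (h s); rewrite (dC a); lra.
Qed.

End metric.

Lemma hausdorff_metrizable (R : realType) (T : pseudoMetricType R) :
  hausdorff_space T -> metrizable_space R T.
Proof.
(* The extended distance [edist] may be infinite; truncating it at 1 gives a finite metric with the
   same small balls. *)
move=> hT; pose d (x y : T) : R := fine (mine (edist (x, y)) 1%:E).
have dE x y : (d x y)%:E = mine (edist (x, y)) 1%:E.
  rewrite /d; have := edist_ge0 (x, y).
  by case: (edist (x, y)) => [r| |] //= _; rewrite ?minye // /mine; case: ifP.
have d_ball x y e : 0 < e <= 1 -> d x y < e -> ball x e y.
  move=> /andP[e0 e1]; rewrite -lte_fin dE /mine; case: ifPn => [_|_].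
    exact: edist_lt_ball.
  by rewrite lte_fin ltNge e1.
have min1 (e : R) : 0 < e -> 0 < Num.min e 1 <= 1.
  by move=> e0; rewrite lt_min e0 ltr01 ge_min lexx orbT.
have ball_d x y e : 0 < e -> ball x e y -> d x y <= e.
  move=> e0 xey; rewrite -lee_fin dE ge_min.
  by rewrite (@edist_fin _ _ _ (x, y)).
have dD x y z : d x z <= d x y + d y z.
  have := edist_triangle x y z; have := edist_ge0 (x, z).
  have := edist_ge0 (x, y); have := edist_ge0 (y, z).
  rewrite -lee_fin EFinD !dE.
  case: (edist (x, y)) (edist (y, z)) (edist (x, z)) => [a| |] [b| |] [c| |] //=;
    rewrite ?minye -?EFin_min -?EFinD ?lee_fin // => *;
    rewrite /Num.min; repeat case: ifPn => ?; lra.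
have dC x y : d x y = d y x by rewrite /d edist_sym.
have dxx x : d x x = 0.
  apply/eqP; rewrite eq_le; apply/andP; split.
    by apply/ler_addgt0Pl => e e0; rewrite addr0; apply/ball_d/ballxx.
  by rewrite -lee_fin dE le_min edist_ge0 lee_fin ler01.
have d0 x y : d x y = 0 -> x = y.
  move=> dxy; apply: hT => A B /nbhs_ballP[e /= e0 eA] /nbhs_ballP[e' /= e'0 eB].
  exists y; split; last exact/eB/ballxx.
  apply: eA; apply: (@le_ball _ _ _ (Num.min e 1)); first by rewrite ge_min lexx.
  by apply: d_ball (min1 _ e0) _; rewrite dxy; case/andP: (min1 _ e0).
exists d; split => //; first by split => [/d0//|->].
move=> x; rewrite predeqE => A; split.
  move=> /nbhs_ballP[e /= e0 eA]; exists (Num.min e 1).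
    by rewrite /= lt_min e0 ltr01.
  move=> y /= dxy; apply: eA; apply: (@le_ball _ _ _ (Num.min e 1)).
    by rewrite ge_min lexx.
  exact: d_ball (min1 _ e0) dxy.
(* The radius is halved because [ball_d] only yields a non-strict inequality. *)
move=> [e /= e0 eA]; apply/nbhs_ballP; exists (e / 2); first by rewrite /= divr_gt0.
move=> y /ball_d xy; apply: eA => /=; apply: (le_lt_trans (xy _)).
  by rewrite divr_gt0.
by lra.
Qed.

(** * Subspaces of the space of real sequences *)

Lemma set_type_seq_hausdorff (R : realType) (A : set {ptws nat -> R}) :
  hausdorff_space A.
Proof.
apply: (@continuous_injective_hausdorff A {ptws nat -> R} \val).
- exact: initial_continuous.
- exact: val_inj.
- by apply: hausdorff_product => _; exact: Rhausdorff.
Qed.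

(** There are countably many boxes that constrain finitely many coordinates around rational centres;
    one point of [A] chosen in each box that meets [A] gives a dense set. *)
Lemma set_type_seq_separable (R : realType) (A : set {ptws nat -> R}) :
  separable_space A.
Proof.
pose B (w : nat * seq rat) : set A :=
  [set z | forall i, (i < w.1)%N ->
     `|\val z i - ratr (nth 0 w.2 i)| < w.1.+1%:R^-1].
pose pt w : option A :=
  if pselect (exists z, B w z) is left Bw then Some (projT1 (cid Bw)) else None.
exists (some @^-1` range pt).
  apply: sub_countable (card_ge_preimage _) _; first by move=> ? ? _ _ [].
  exact: sub_countable (card_image_le _ _) (countableP _).
move=> _ /[swap] -[V oV <-] [y Vy].
(* The factor 2 appears because [y] and the chosen point are each within [k.+1%:R^-1] of the same
   rational centre. These boxes form a filter base converging to [y], so one of them lies in [V]. *)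
pose box k : set {ptws nat -> R} :=
  [set z | forall i, (i < k)%N -> `|\val y i - z i| <= 2 * k.+1%:R^-1].
have boxS j k : (j <= k)%N -> box k `<=` box j.
  move=> jk z zk i ij; apply: le_trans (zk _ (leq_trans ij jk)) _.
  by rewrite ler_pM2l// lef_pV2 ?posrE// ler_nat ltnS.
have Fbox : Filter (filter_from setT box).
  apply: filter_from_filter; first by exists 0%N.
  move=> j k _ _; exists (maxn j k) => // z zjk; split.
    by apply: boxS zjk; exact: leq_maxl.
  by apply: boxS zjk; exact: leq_maxr.
have cvg_box : {ptws, filter_from setT box --> (\val y : nat -> R)}.
  apply/pointwise_cvgP => i; apply/cvgrPdist_le => e e0.
  have e20 : 0 < e / 2 by rewrite divr_gt0.
  have [N _ Ne] := near_infty_natSinv_lt (PosNum e20).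
  (* The index exceeds [i], so that coordinate [i] is constrained, and is at least [N], so that the
     radius is below [e]. *)
  exists (maxn N i.+1) => // z /(_ i); rewrite /= leq_maxr => /(_ isT) zi.
  apply: (le_trans zi); have /= := Ne (maxn N i.+1) (leq_maxl _ _).
  by rewrite ltr_pdivlMr// mulrC => /ltW.
have [k _ kV] : filter_from setT box V by apply/cvg_box/open_nbhs_nbhs.
have /choice[r yr] (i : nat) :
    exists q : rat, `|\val y i - ratr q| < k.+1%:R^-1 :> R.
  have k0 : (0 : R) < k.+1%:R^-1 by rewrite invr_gt0.
  have [|q] := @rat_in_itvoo R (\val y i - k.+1%:R^-1) (\val y i + k.+1%:R^-1).
    by rewrite ltrBlDr -addrA ltrDl addr_gt0.
  by rewrite in_itv/= => qi; exists q; rewrite distrC ltr_distl.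
pose w := (k, mkseq r k).
have Bwy : B w y.
  move=> i; rewrite /w /= => ik; rewrite nth_mkseq//; exact: yr.
have : pt w = pt w by [].
rewrite {2}/pt; case: pselect => [Bw|]; last by case; exists y.
case: cid => z /= Bwz ptw; exists z; split; last by exists w.
apply: kV => i ik; have := Bwz _ ik; rewrite /= nth_mkseq// distrC => zi.
rewrite mulr_natl mulr2n.
exact: le_trans (ler_distD (ratr (r i)) _ _) (lerD (ltW (yr i)) (ltW zi)).
Qed.

Lemma continuous_pair (S T U : topologicalType) (f : S -> T) (g : S -> U) :
  continuous f -> continuous g -> continuous (fun x => (f x, g x)).
Proof. by move=> cf cg x; apply: cvg_pair; [exact: cf|exact: cg]. Qed.

Lemma continuous_prod_map (T : topologicalType) (I : eqType)
    (A B : I -> topologicalType) (Z : topologicalType)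
    (h : forall i, A i -> B i) (g : T * prod_topology B -> Z)
    (f : T * prod_topology A -> Z) :
  (forall i, continuous (h i)) -> continuous g ->
  (forall c x, f (c, x) = g (c, fun i => h i (x i))) -> continuous f.
Proof.
move=> ch cg fE.
have -> : f = g \o (fun p => (p.1, (fun i => h i (p.2 i)) : prod_topology B)).
  by apply/funext => -[c x]; exact: fE.
move=> p; apply: (@continuous_comp _ _ _ _ g); last exact: cg.
apply: continuous_pair => {p} [p|]; first exact: cvg_fst.
apply: continuous_prod_topology => i p.
have cpi : {for p, continuous (fun p : T * prod_topology A => p.2 i)}.
  apply: (@continuous_comp _ (prod_topology A) _ snd (@proj I A i)).
    exact: cvg_snd.
  exact: proj_continuous.
exact: continuous_comp cpi (ch i _).
Qed.

(** * Factorizability over a space as continuity for an induced topology *)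

Lemma countable_enum (T : Type) (D : set T) :
  countable D ->
  exists q : nat -> option T, forall y, D y -> exists k, q k = Some y.
Proof.
move=> /countable_injP[e einj].
(* The value [None] marks the numbers that code no element, and allows [D] to be empty. *)
exists (fun k => if pselect (exists y, D y /\ e y = k) is left h
                 then Some (projT1 (cid h)) else None) => y Dy; exists (e y).
case: pselect => [h|]; last by case; exists y.
case: cid => z /= [Dz ezy]; congr Some.
by apply: einj; rewrite ?inE.
Qed.

(** The finitely many maps [h i] are replaced by one sequence [psi] of distances to dense points.
    Each [h i] stays continuous for the topology induced by [psi], hence so does [f], which factors
    through them. *)
Lemma Rfactorizable_over_initial (R : realType) (T X : topologicalType)
    (n : nat) (hX : Rfactorizable_over R T (fun _ : 'I_n => X))
    (f : T * {ptws 'I_n -> X} -> R) (cf : continuous f) :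
  exists psi : X -> {ptws nat -> R}, continuous psi /\
    continuous (f : T * {ptws 'I_n -> initial_topology psi} -> R).
Proof.
have [Y [h [g [Ysm ch cg fE]]]] := hX f cf.
have /all_sig[q qE] i : {q : nat -> option (Y i) |
    dense [set y | exists k, q k = Some y]}.
  apply: cid.
  have [[D cD dD] _] := Ysm i; have [q qD] := countable_enum cD.
  by exists q => O O0 oO; have [y [Oy /qD Dy]] := dD O O0 oO; exists y.
have /all_sig[d dP] i : {d : Y i -> Y i -> R | [/\ forall x, d x x = 0,
    forall x y, d x y = d y x, forall x y z, d x z <= d x y + d y z &
    forall x, nbhs x = nbhs_ball_ (fun y e => [set z | d y z < e]) x]}.
  by apply: cid; have [_ [d [d0 ? ? ?]]] := Ysm i; exists d;
    split => // x; apply/d0.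
(* Coordinate [pickle (i, k)] is the distance from [h i x] to the [k]-th dense point of [Y i];
   indices that code nothing get the constant 0. *)
pose psi (x : X) : {ptws nat -> R} := fun m =>
  if unpickle m is Some (i, k) then
    if q i k is Some y then d i (h i x) y else 0
  else 0.
have cpsi : continuous psi.
  apply: continuous_prod_topology => m x; rewrite /psi.
  case: (unpickle m) => [[i k]|]; last exact: cvg_cst.
  case: (q i k) => [y|]; last exact: cvg_cst.
  have [dxx dC dD dE] := dP i.
  apply: (@continuous_comp _ _ _ (h i) (d i ^~ y)); first exact: ch.
  exact: continuous_dist.
exists psi; split => //; rewrite fE.
pose h' i : initial_topology psi -> Y i := h i.
have ch' i : continuous (h' i).
  have [dxx dC dD dE] := dP i.
  apply: (continuous_dist_dense dxx dC dD dE (qE i)) => y [k qy] x.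
  have -> : (fun t => d i (h' i t) y) =
      @proj _ (fun=> R) (pickle (i, k)) \o (psi : initial_topology psi -> _).
    by apply/funext => t; rewrite /= /proj /psi pickleK qy.
  apply: (@continuous_comp (initial_topology psi) {ptws nat -> R}).
    exact: initial_continuous.
  exact: proj_continuous.
exact: (continuous_prod_map ch' cg).
Qed.

(* [x] and [y] are the values of a continuous map on a two-point indiscrete
   space, whose composition with [f] is constant as [R] is Hausdorff. *)
Lemma continuous_initial_factor (R : realType) (T X : topologicalType)
    (n : nat) (Z : topologicalType) (psi : X -> Z)
    (f : T * {ptws 'I_n -> X} -> R) (c : T) (x y : {ptws 'I_n -> X}) :
  continuous (f : T * {ptws 'I_n -> initial_topology psi} -> R) ->
  (forall i, psi (x i) = psi (y i)) -> f (c, x) = f (c, y).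
Proof.
move=> cf xy.
pose I : topologicalType := initial_topology (fun _ : bool => 0 : R).
pose t (b : I) : {ptws 'I_n -> initial_topology psi} := if b then x else y.
have ct : continuous t.
  apply: continuous_prod_topology => i.
  apply: continuous_comp_initial.
  have -> : psi \o (fun b => t b i) = cst (psi (x i)).
    by apply/funext => -[] //=; rewrite xy.
  exact: cst_continuous.
have cft : continuous (fun b : I => f (c, t b)).
  have cp := continuous_pair (@cst_continuous I T c) ct.
  by move=> b; exact: continuous_comp (cp b) (cf _).
apply: (@Rhausdorff R) => A B /(cft true) fA /(cft false) fB.
exists (f (c, t false)); split; last exact: nbhs_singleton fB.
have : nbhs (true : I) [set b | A (f (c, t b))] by [].
rewrite nbhsE => -[W [oW Wt] WA]; apply: (WA false).
have [U _ UW] : exists2 U : set R, open U & (fun=> 0) @^-1` U = W := oW.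
by move: Wt; rewrite -UW.
Qed.

(** * A countable family of functions closed under factoring the operations *)

Section closed_family.
Context (R : realType) (E : topologicalType) (E_ : nat -> set E).
Context (X : topEalgebra E_).
Hypothesis hX : forall n : nat, Sp E_ n ->
  Rfactorizable_over R (set_type (E_ n)) (fun _ : 'I_n => ealg_sort X).

Definition op_continuous_for (F : X -> {ptws nat -> R}) (n : nat)
    (phi : X -> R) : Prop :=
  continuous ((fun p => phi (ealg_op p)) :
    E_ n * {ptws 'I_n -> initial_topology F} -> R).

Lemma op_continuous_for_ex (n : nat) (phi : X -> R) : continuous phi ->
  exists psi : X -> {ptws nat -> R},
    continuous psi /\ op_continuous_for psi n phi.
Proof.
move=> cphi; have [nE|nE] := pselect (Sp E_ n).
  apply: (@Rfactorizable_over_initial R (E_ n) X n (hX nE)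
    (fun p => phi (ealg_op p))) => p.
  apply: (@continuous_comp _ X _ (@ealg_op _ _ X n) phi).
    exact: ealg_op_continuous.
  exact: cphi.
(* Here [E_ n] is empty, so the domain of the operation is empty and any [psi] works. *)
exists (fun _ _ => 0); split; first exact: cst_continuous.
by move=> [[c Ec] x]; case: nE; exists c; exact: set_mem.
Qed.

(** The stages of the closure are indexed by finite words of pairs (arity, coordinate). These words
    are countable, so all stages fit into one sequence [F]. *)
Lemma op_continuous_for_family (f : X -> R) : continuous f ->
  exists F : X -> {ptws nat -> R}, [/\ continuous F,
    exists m, f = F ^~ m & forall m n, op_continuous_for F n (F ^~ m)].
Proof.
move=> cf.
(* [Psi] is chosen for all functions at once, with a dummy value at discontinuous ones, so that it
   can be iterated before [G s] is known to be continuous. *)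
have /choice[Psi PsiP] (nphi : nat * (X -> R)) :
    exists psi : X -> {ptws nat -> R}, continuous nphi.2 ->
      continuous psi /\ op_continuous_for psi nphi.1 nphi.2.
  have [cphi|ncphi] := pselect (continuous nphi.2); last first.
    by exists (fun _ _ => 0).
  by have [psi psiP] := op_continuous_for_ex nphi.1 cphi; exists psi.
pose G : seq (nat * nat) -> X -> R :=
  foldr (fun nk phi => (Psi (nk.1, phi)) ^~ nk.2) f.
pose F (x : X) : {ptws nat -> R} :=
  fun m => if unpickle m is Some s then G s x else 0.
have FG s : F ^~ (pickle s) = G s.
  by apply/funext => x; rewrite /F pickleK.
have cG s : continuous (G s).
  elim: s => [//|[n k] s IHs] x.
  apply: (@continuous_comp _ {ptws nat -> R} _ (Psi (n, G s))
    (@proj _ (fun=> R) k)); last exact: proj_continuous.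
  by have [/= cPsi _] := PsiP (n, G s) IHs; exact: cPsi.
exists F; split; last 1 first.
- move=> m n; have [[s Fm]|Fm] : (exists s, F ^~ m = G s) \/ F ^~ m = cst 0.
    rewrite /F; case: (unpickle m) => [s|]; last by right.
    by left; exists s.
  rewrite {}Fm.
  (* The [k]-th coordinate of [Psi (n, G s)] is [G ((n, k) :: s)], itself a coordinate of [F]. So
     [F] induces a finer topology than [Psi (n, G s)], and the identity [i j] is continuous. *)
  pose i (j : 'I_n) : initial_topology F -> initial_topology (Psi (n, G s)) :=
    id.
  have ci j : continuous (i j).
    apply: continuous_comp_initial; apply: continuous_prod_topology => k.
    pose F' : initial_topology F -> {ptws nat -> R} := F.
    have -> : (fun x => (Psi (n, G s) \o i j) x k) =
        @proj _ (fun=> R) (pickle ((n, k) :: s)) \o F'.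
      by apply/funext => x; rewrite /= /proj /F' /F pickleK.
    move=> x; apply: (@continuous_comp _ {ptws nat -> R}).
      exact: initial_continuous.
    exact: proj_continuous.
  have [_ /= cop] := PsiP (n, G s) (cG s).
  exact: (continuous_prod_map ci cop).
- by rewrite Fm; exact: cst_continuous.
- apply: continuous_prod_topology => m.
  rewrite /F; case: (unpickle m) => [s|]; first exact: cG.
  exact: cst_continuous.
- by exists (pickle ([::] : seq (nat * nat))); rewrite FG.
Qed.

End closed_family.

(** * The algebra structure on the image of the family *)

Section image_algebra.
Context (R : realType) (E : topologicalType) (E_ : nat -> set E).
Context (X : topEalgebra E_) (F : X -> {ptws nat -> R}).
Hypothesis cF : continuous F.
Hypothesis opF : forall m n, op_continuous_for F n (F ^~ m).

(** Operations on the image are computed on representatives given by a section [r] of [F]. This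
    section need not be continuous into [X], but it is for the topology induced by [F], which is the
    one that [opF] refers to. *)
Lemma image_algebra_ex : exists (Z : topEalgebra E_) (v : Z -> {ptws nat -> R})
    (h : X -> Z), [/\ separable_space Z /\ metrizable_space R Z, continuous v,
      continuous h /\ ehomomorphism h & F = v \o h].
Proof.
pose Y : set {ptws nat -> R} := range F.
pose h (x : X) : Y := SigSub (mem_set (imageT F x)).
have /all_sig[r rE] (y : Y) : {x : initial_topology F | F x = \val y}.
  by apply: cid; have [x _ Fx] := set_mem (valP y); exists x.
have cr : continuous r.
  apply: continuous_comp_initial; have -> : F \o r = \val by apply/funext.
  exact: initial_continuous.
pose op : ealgebra_ops E_ Y := fun n p => h (ealg_op (p.1, r \o p.2)).
have cop n : continuous (@op n).
  apply: continuous_comp_initial; apply: continuous_prod_topology => m.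
  exact: (continuous_prod_map (fun=> cr) (@opF m n)).
have ty : Defs.tychonoff Y.
  by split; [exact: set_type_seq_hausdorff|exact: uniform_completely_regular].
exists (TopEalgebra ty cop), \val, h; split => //.
- split; first exact: set_type_seq_separable.
  apply: hausdorff_metrizable; exact: set_type_seq_hausdorff.
- exact: initial_continuous.
- split; first by apply: continuous_comp_initial; exact: cF.
  move=> n c x; apply: val_inj; apply/funext => m /=.
  (* The tuples [x] and [r \o (h \o x)] have the same image under [F] entrywise, and [opF] makes the
     result depend only on that image. *)
  apply: (@continuous_initial_factor R _ _ _ _ F (fun p => F (ealg_op p) m)).
    exact: opF.
  by move=> i; rewrite /= rE.
Qed.

End image_algebra.

Theorem theorem12 (R : realType) (E : topologicalType) (E_ : nat -> set E)
    (hE : continuous_signature E_) (X : topEalgebra E_)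
    (hX : forall n : nat, Sp E_ n ->
      Rfactorizable_over R (set_type (E_ n)) (fun _ : 'I_n => ealg_sort X)) :
  Rfactorizable R X.
Proof.
move=> f cf; have [F [cF [m ->] opF]] := op_continuous_for_family hX cf.
have [Y [v [h [Ysm cv ch ->]]]] := image_algebra_ex cF opF.
(* As [f] is the [m]-th coordinate of [F], the outer function is the [m]-th coordinate of [v]. *)
exists Y, (fun y => v y m), h; split => //.
move=> y; apply: (@continuous_comp _ {ptws nat -> R} _ v (@proj _ (fun=> R) m)).
  exact: cv.
exact: proj_continuous.
Qed.
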